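(* Assume that $\mathcal D_{g_0}:T_{p_0}S\to T_{a_0}\mathscr X_{\mathrm{core}}$ is injective, where $a_0=\mathcal A_{E,\mathrm{core}}(p_0)$, and allow unrestricted smooth local scalar postprocessings of the core package (all smooth real functions defined near $a_0$ on $\mathscr X_{\mathrm{core}}$). If $m=\dim S$, then there exist $m$ smooth scalar core-package-generated observations $\psi_i\circ\mathcal A_{E,\mathrm{core}}$, $i=1,\dots,m$, whose joint differential at $p_0$ is an isomorphism onto $\mathbb R^m$. Consequently their joint map is a local diffeomorphism near $p_0$ and locally reconstructs the parameter point. If $p\mapsto g_p$ is locally injective, it locally reconstructs the corresponding Einstein metric within the chosen family.
   Context: $S$ is a smooth finite-dimensional manifold parameterizing a smooth family $p\mapsto g_p$ of normalized cohomogeneity-one Einstein metrics ($\operatorname{Ric}(g_p)=\lambda g_p$, $\lambda>0$ fixed, invariant under a fixed Lie group action, normalized by a fixed unit-speed normal geodesic) on a compact manifold $M$, with $g_{p_0}=g_0$ the reference metric. Fixed probe data are given: a compact Riemannian target $(N,h)$ with compatible group action, an equivariant homotopy class of maps $M\to N$ with endpoint, smoothness and normalization conditions, and a reference harmonic map $f_0$ for $g_0$. Under normalized Jacobi nondegeneracy (the linearization at $f_0$ of the tension field in the map variable, between the constrained equivariant $C^{k+2,\alpha}$ and $C^{k,\alpha}$ Hölder spaces, $k\ge4$, $0<\alpha<1$, is an isomorphism) and after shrinking $S$ around $p_0$, each $g_p$ has a unique harmonic map $f_p$ near $f_0$, depending smoothly on $p$; $J_p$ denotes the linearization at $f_p$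 of the tension field $f\mapsto\tau_{g_p}(f)$, which is invertible, and $G_p=J_p^{-1}$. The (descended) core analytical package is the smooth map $\mathcal A_{E,\mathrm{core}}:S\to\mathscr X_{\mathrm{core}}$, $p\mapsto(J_p,G_p)$, where (after fixed local trivializations) $\mathscr X_{\mathrm{core}}$ is a Banach manifold of operator data. The universal response differential is $\mathcal D_{g_0}:=D_{p_0}\mathcal A_{E,\mathrm{core}}$. A scalar core-package-generated observation is a function $\psi\circ\mathcal A_{E,\mathrm{core}}$ with $\psi$ a smooth real-valued function near $a_0$. *)

(* Defs.v *)
From HB Require Import structures.
From mathcomp Require Import all_boot all_order all_algebra.
From mathcomp Require Import all_classical all_reals all_analysis.
Set Implicit Arguments.
Unset Strict Implicit.
Unset Printing Implicit Defensive.
Import Order.TTheory GRing.Theory Num.Theory.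
Import numFieldNormedType.Exports.
Local Open Scope classical_set_scope.
Local Open Scope ring_scope.

Section bounded_operators.
Context {R : realType} (E F : normedModType R).

Definition bounded_op : {pred E -> F} := fun f : E -> F =>
  `[< linear f /\ exists C : R, forall x, `|f x| <= C * `|x| >].

Record bop := Bop { bop_fun :> E -> F; bopP : bop_fun \in bounded_op }.

HB.instance Definition _ := [isSub for bop_fun].
HB.instance Definition _ := [Choice of bop by <:].

Lemma bounded_op_submod : submod_closed bounded_op.
Proof.
split.
  apply/asboolP; split; first by move=> a u v /=; rewrite scaler0 addr0.
  by exists 0 => x; rewrite normr0 mul0r.
move=> a u v /asboolP[ul [C uC]] /asboolP[vl [D vD]]; apply/asboolP; split.
  move=> b x y; change (a *: u (b *: x + y) + v (b *: x + y)
    = b *: (a *: u x + v x) + (a *: u y + v y)).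
  rewrite ul vl !scalerDr !scalerA (mulrC a b).
  by rewrite -!addrA; congr +%R; rewrite addrCA.
exists (`|a| * C + D) => x.
change (`|a *: u x + v x| <= (`|a| * C + D) * `|x|).
rewrite (le_trans (ler_normD _ _))// mulrDl lerD// normrZ -mulrA.
by rewrite ler_wpM2l.
Qed.

HB.instance Definition _ :=
  GRing.isSubmodClosed.Build R (E -> F) bounded_op bounded_op_submod.
HB.instance Definition _ := [SubChoice_isSubLmodule of bop by <:].

Definition opnorm (f : bop) : R := sup [set `|f x| | x in [set x | `|x| <= 1]].

Lemma bop_linear (f : bop) : linear f.
Proof. by case: f => f /= /asboolP[]. Qed.

Lemma bop0 (f : bop) : f 0 = 0.
Proof. by have := bop_linear f (-1) 0 0; rewrite scaler0 addr0 scaleN1r addNr. Qed.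

Lemma bopZ (f : bop) a x : f (a *: x) = a *: f x.
Proof. by have := bop_linear f a x 0; rewrite addr0 bop0 addr0. Qed.

Lemma opnorm_has_sup (f : bop) :
  has_sup [set `|f x| | x in [set x | `|x| <= 1]].
Proof.
split; first by exists `|f 0|, 0 => //=; rewrite normr0.
have [_ [C fC]] := asboolP _ (bopP f).
exists `|C| => _ [x /= x1 <-]; apply: (le_trans (fC x)).
rewrite (le_trans (ler_norm _))// normrM normr_id -[leRHS]mulr1.
by rewrite ler_wpM2l.
Qed.

Lemma opnorm_unit (f : bop) x : `|x| <= 1 -> `|f x| <= opnorm f.
Proof. by move=> x1; apply: (sup_upper_bound (opnorm_has_sup f)); exists x. Qed.

Lemma opnorm_le (f : bop) b :
  (forall x, `|x| <= 1 -> `|f x| <= b) -> opnorm f <= b.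
Proof.
move=> fb; apply: sup_le_ub; first by case: (opnorm_has_sup f).
by move=> _ [x x1 <-]; exact: fb.
Qed.

Lemma opnorm_ge0 (f : bop) : 0 <= opnorm f.
Proof. by apply: le_trans (opnorm_unit f (x := 0) _); rewrite ?normr0. Qed.

Lemma opnormP (f : bop) x : `|f x| <= opnorm f * `|x|.
Proof.
have [->|x0] := eqVneq x 0; first by rewrite bop0 !normr0 mulr0.
have nx : 0 < `|x| by rewrite normr_gt0.
rewrite -ler_pdivrMr// mulrC -[leLHS]ger0_norm ?mulr_ge0 ?invr_ge0//.
rewrite normrM normr_id -normrZ -bopZ; apply: opnorm_unit.
by rewrite normrZ normfV normr_id mulVf// gt_eqF.
Qed.

Lemma opnormD (f g : bop) : opnorm (f + g) <= opnorm f + opnorm g.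
Proof.
apply: opnorm_le => x x1; change (`|f x + g x| <= opnorm f + opnorm g).
by rewrite (le_trans (ler_normD _ _))// lerD// opnorm_unit.
Qed.

Lemma opnormZ (a : R) (f : bop) : opnorm (a *: f) = `|a| * opnorm f.
Proof.
apply/eqP; rewrite eq_le; apply/andP; split.
  apply: opnorm_le => x x1; change (`|a *: f x| <= `|a| * opnorm f).
  by rewrite normrZ ler_wpM2l// opnorm_unit.
have [->|a0] := eqVneq a 0; first by rewrite normr0 mul0r opnorm_ge0.
rewrite -ler_pdivlMl ?normr_gt0//; apply: opnorm_le => x x1.
rewrite ler_pdivlMl ?normr_gt0// -normrZ.
exact: (opnorm_unit (a *: f)).
Qed.

Lemma opnorm0_eq0 (f : bop) : opnorm f = 0 -> f = 0.
Proof.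
move=> f0; apply: val_inj; apply/funext => x.
change (f x = 0); apply/eqP; rewrite -normr_le0.
by have := opnormP f x; rewrite f0 mul0r.
Qed.

HB.instance Definition _ :=
  @Lmodule_isNormed.Build R bop opnorm opnormD opnormZ opnorm0_eq0.

End bounded_operators.

(* C^n maps through iterated tangent maps. For finite n this is the usual C^n
   in finite dimension; for n = oo it is the usual (Frechet) smoothness in all
   normed spaces. U is meant to be open. *)
Fixpoint Cn (R : realType) (n : nat) (E F : normedModType R)
    (U : set E) (f : E -> F) {struct n} : Prop :=
  if n is n'.+1 then
    (forall x, U x -> differentiable f x) /\
    Cn n' (U `*` [set: E]) (fun z : E * E => 'd f (z.1) (z.2))
  else forall x, U x -> {for x, continuous f}.

Definition smooth_on (R : realType) (E F : normedModType R)
  (U : set E) (f : E -> F) : Prop := forall n, Cn n U f.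

Section manifolds.
Context {R : realType}.

Record chart (T : topologicalType) (V : normedModType R) := Chart {
  cdom : set T;
  cmap : T -> V;
  cinv : V -> T;
  cdom_open : open cdom;
  cimg_open : open (cmap @` cdom);
  cmapK : forall x, cdom x -> cinv (cmap x) = x;
  cmap_continuous : forall x, cdom x -> {for x, continuous cmap};
  cinv_continuous : forall z, (cmap @` cdom) z -> {for z, continuous cinv}
}.

(* The atlas is [range chart_at], with a preferred chart at every point. The
   tangent space at x is V, a vector being given by its coordinates in
   [chart_at x]. *)
Record manifold (V : normedModType R) := Manifold {
  mcarrier :> topologicalType;
  chart_at : mcarrier -> chart mcarrier V;
  chart_at_dom : forall x, cdom (chart_at x) x;
  chart_compat : forall x y,
    smooth_on (cmap (chart_at x) @` (cdom (chart_at x) `&` cdom (chart_at y)))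
              (cmap (chart_at y) \o cinv (chart_at x));
  manifold_hausdorff : hausdorff_space mcarrier
}.

Record smooth_manifold (n : nat) := SmoothManifold {
  smanifold :> manifold 'rV[R]_n;
  smanifold_second_countable : @second_countable smanifold
}.

Section flat.
Variable V : normedModType R.

Lemma flat_open : open ((@id V) @` [set: V]).
Proof. by rewrite image_id; exact: openT. Qed.

Definition flat_chart : chart V V :=
  @Chart V V [set: V] id id openT flat_open (fun _ _ => erefl)
    (fun x _ => @cvg_id _ (nbhs x)) (fun x _ => @cvg_id _ (nbhs x)).

Lemma Cn_linear (n : nat) (E F : normedModType R) (U : set E) (f : E -> F) :
  linear f -> continuous f -> Cn n U f.
Proof.
elim: n E F U f => [|n IHn] E F U f lf cf /=; first by move=> x _; exact: cf.
pose g : {linear E -> F} := HB.pack f (GRing.isLinear.Build R E F _ f lf).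
split=> [x _|]; first exact: (@linear_differentiable R E F g x cf).
rewrite (_ : (fun z : E * E => _) = (fun z => f z.2)).
  by apply: IHn => [a u v|z]; [exact: lf|apply: (continuous_comp (g := f));
    [exact: cvg_snd|exact: cf]].
by apply/funext => z /=; rewrite (@diff_lin R E F g _ cf).
Qed.

Lemma flat_compat (x y : V) :
  smooth_on (cmap flat_chart @` (cdom flat_chart `&` cdom flat_chart))
            (cmap flat_chart \o cinv flat_chart).
Proof. by move=> n; apply: Cn_linear => // z; exact: cvg_id. Qed.

Definition flat : manifold V :=
  @Manifold V V (fun _ => flat_chart) (fun _ => I) flat_compat
    (@norm_hausdorff R V).
End flat.

Section maps.
Variables (V1 V2 V3 : normedModType R).
Variables (M1 : manifold V1) (M2 : manifold V2) (M3 : manifold V3).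

Definition chart_rep (f : M1 -> M2) (x : M1) : V1 -> V2 :=
  cmap (chart_at (f x)) \o f \o cinv (chart_at x).

Definition mdiff (f : M1 -> M2) (x : M1) : V1 -> V2 :=
  'd (chart_rep f x) (cmap (chart_at x) x).

Definition msmooth_at (f : M1 -> M2) (x : M1) : Prop :=
  exists W : set M1, [/\ open W, W x, W `<=` cdom (chart_at x),
    f @` W `<=` cdom (chart_at (f x)) &
    smooth_on (cmap (chart_at x) @` W) (chart_rep f x)].

Definition msmooth_on (U : set M1) (f : M1 -> M2) : Prop :=
  forall x, U x -> msmooth_at f x.

Definition msmooth2_at (f : M1 -> M2 -> M3) (x : M1) (y : M2) : Prop :=
  exists (W1 : set M1) (W2 : set M2),
    [/\ open W1 /\ open W2, W1 x /\ W2 y,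
     W1 `<=` cdom (chart_at x) /\ W2 `<=` cdom (chart_at y),
     forall x' y', W1 x' -> W2 y' -> cdom (chart_at (f x y)) (f x' y') &
     smooth_on ((cmap (chart_at x) @` W1) `*` (cmap (chart_at y) @` W2))
       (fun z : V1 * V2 => cmap (chart_at (f x y))
          (f (cinv (chart_at x) z.1) (cinv (chart_at y) z.2)))].
End maps.

Definition local_diffeo_at (V1 V2 : normedModType R)
  (M1 : manifold V1) (M2 : manifold V2) (f : M1 -> M2) (x : M1) : Prop :=
  exists (U : set M1) (W : set M2) (finv : M2 -> M1),
    [/\ open U /\ open W, U x /\ f @` U = W, forall y, U y -> finv (f y) = y,
     msmooth_on U f & msmooth_on W finv].

(* Coordinates in the chart q' of the tangent vector at x whose coordinates
   in the chart q are v. *)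
Definition tchange (V : normedModType R) (M : manifold V) (q q' x : M) (v : V) : V :=
  'd (cmap (chart_at q') \o cinv (chart_at q)) (cmap (chart_at q) x) v.

Record lie_group (l : nat) := LieGroup {
  lg_manifold :> smooth_manifold l;
  lg_mul : lg_manifold -> lg_manifold -> lg_manifold;
  lg_one : lg_manifold;
  lg_inv : lg_manifold -> lg_manifold;
  lg_mulA : associative lg_mul;
  lg_mul1 : left_id lg_one lg_mul;
  lg_mulV : left_inverse lg_one lg_inv lg_mul;
  lg_mul_smooth : forall a b, msmooth2_at lg_mul a b;
  lg_inv_smooth : msmooth_on setT lg_inv
}.

Record lie_action (l n : nat) (K : lie_group l) (M : smooth_manifold n) :=
  LieAction {
  act :> K -> M -> M;
  act_one : forall x, act (lg_one K) x = x;
  act_mul : forall a b x, act (lg_mul a b) x = act a (act b x);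
  act_smooth : forall a x, msmooth2_at act a x
}.

Definition infinitesimal_action (l n : nat) (K : lie_group l)
  (M : smooth_manifold n) (a : lie_action K M) (x : M) (X : 'rV[R]_l) : 'rV[R]_n :=
  mdiff (fun c : K => a c x) (lg_one K) X.

(* The differential of the orbit map at 1 has the tangent space of the orbit
   as its image. *)
Definition orbit_dim (l n : nat) (K : lie_group l)
  (M : smooth_manifold n) (a : lie_action K M) (x : M) : nat :=
  \rank (lin1_mx (infinitesimal_action a x)).

Definition cohomogeneity_one (l n : nat) (K : lie_group l)
  (M : smooth_manifold n) (a : lie_action K M) : Prop :=
  (forall x, ((orbit_dim a x).+1 <= n)%N) /\ exists x, (orbit_dim a x).+1 = n.

End manifolds.

Section riemannian.
Context {R : realType} {n : nat}.

Definition partial (W : normedModType R) (i : 'I_n) (f : 'rV[R]_n -> W)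
  (z : 'rV[R]_n) : W := 'D_(delta_mx 0 i) f z.

Definition partials (W : normedModType R) (s : seq 'I_n) (f : 'rV[R]_n -> W) :
  'rV[R]_n -> W := foldr (@partial W) f s.

Definition christoffel (G : 'rV[R]_n -> 'M[R]_n) (z : 'rV[R]_n)
  (i j k : 'I_n) : R :=
  2^-1 * \sum_(l < n) invmx (G z) k l *
    (partial i (fun y => G y j l) z + partial j (fun y => G y i l) z
     - partial l (fun y => G y i j) z).

(* Sign convention: round spheres have positive Ricci curvature. *)
Definition ricci (G : 'rV[R]_n -> 'M[R]_n) (z : 'rV[R]_n) (i j : 'I_n) : R :=
  \sum_(k < n) (partial k (fun y => christoffel G y i j k) z
                - partial j (fun y => christoffel G y i k k) z)
  + \sum_(k < n) \sum_(l < n)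
      (christoffel G z k l k * christoffel G z i j l
       - christoffel G z j l k * christoffel G z i k l).

Variable M : smooth_manifold (R := R) n.

Implicit Types g : M -> 'M[R]_n.

Definition inner g (x : M) (v w : 'rV[R]_n) : R := (v *m g x *m w^T) 0 0.

Definition metric_rep g (q : M) (z : 'rV[R]_n) : 'M[R]_n :=
  let x := cinv (chart_at q) z in
  \matrix_(i, j) inner g x (tchange q x x (delta_mx 0 i))
                           (tchange q x x (delta_mx 0 j)).

Definition riemannian g : Prop :=
  [/\ forall x, (g x)^T = g x,
      forall x v, v != 0 -> 0 < inner g x v v &
      forall q : M, smooth_on (cmap (chart_at q) @` cdom (chart_at q))
                              (metric_rep g q)].

Definition einstein (lam : R) g : Prop :=
  forall (x : M) i j,
    ricci (metric_rep g x) (cmap (chart_at x) x) i j = lam * g x i j.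

Definition invariant_metric (l : nat) (K : lie_group l) (a : lie_action K M) g :
  Prop := forall (c : K) (x : M) v w,
    inner g (a c x) (mdiff (a c) x v) (mdiff (a c) x w) = inner g x v w.

Definition curve_rep (gam : R -> M) (t : R) : R -> 'rV[R]_n :=
  fun s => cmap (chart_at (gam t)) (gam s).

Definition velocity (gam : R -> M) (t : R) : 'rV[R]_n :=
  derive1 (curve_rep gam t) t.

Definition geodesic_at g (gam : R -> M) (t : R) : Prop :=
  let v := velocity gam t in
  forall k : 'I_n,
    derive1 (derive1 (curve_rep gam t)) t 0 k
    + \sum_(i < n) \sum_(j < n)
        christoffel (metric_rep g (gam t)) (cmap (chart_at (gam t)) (gam t)) i j k
        * v 0 i * v 0 j = 0.

Definition unit_normal_geodesic (l : nat) (K : lie_group l)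
  (a : lie_action K M) g (len : R) (gam : R -> M) : Prop :=
  forall t, t \in `]0, len[ ->
    [/\ geodesic_at g gam t,
        inner g (gam t) (velocity gam t) (velocity gam t) = 1 &
        forall X, inner g (gam t) (velocity gam t)
                    (infinitesimal_action a (gam t) X) = 0].

End riemannian.

(* The curve [gam], shared by all the metrics, is the normalization. *)
Record einstein_family (R : realType) (m n l : nat) (S : smooth_manifold (R := R) m)
    (M : smooth_manifold (R := R) n) (K : lie_group l) (a : lie_action K M)
    (lam len : R) (gam : R -> M) (g : S -> M -> 'M[R]_n) : Prop := {
  ef_cohomogeneity_one : cohomogeneity_one a;
  ef_len : 0 < len;
  ef_curve : msmooth_on (M1 := flat R) [set t : R | t \in `]0, len[] gam;
  ef_riemannian : forall p, riemannian (g p);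
  ef_invariant : forall p, invariant_metric a (g p);
  ef_einstein : forall p, einstein lam (g p);
  ef_normal : forall p, unit_normal_geodesic a (g p) len gam;
  ef_smooth : forall (s : S) (q : M),
    smooth_on ((cmap (chart_at s) @` cdom (chart_at s)) `*`
               (cmap (chart_at q) @` cdom (chart_at q)))
      (fun z : 'rV[R]_m * 'rV[R]_n =>
         metric_rep (g (cinv (chart_at s) z.1)) q z.2)
}.

Section maps_to_target.
Context {R : realType} {n d l : nat}.
Context {M : smooth_manifold (R := R) n} {N : smooth_manifold (R := R) d}.
Context {K : lie_group (R := R) l}.
Variables (aM : lie_action K M) (aN : lie_action K N).

(* trace_g of the second fundamental form of f, in the coordinates of
   [chart_at x] and [chart_at (f x)] *)
Definition tension (g : M -> 'M[R]_n) (h : N -> 'M[R]_d) (f : M -> N) (x : M) :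
  'rV[R]_d :=
  let z := cmap (chart_at x) x in
  let F := chart_rep f x in
  let G := metric_rep g x in
  let H := metric_rep h (f x) in
  \row_(a < d) \sum_(i < n) \sum_(j < n) invmx (G z) i j *
    (partials [:: i; j] F z 0 a
     - \sum_(k < n) christoffel G z i j k * partial k F z 0 a
     + \sum_(b < d) \sum_(c < d)
         christoffel H (F z) b c a * partial i F z 0 b * partial j F z 0 c).

Definition harmonic g h f := forall x : M, tension g h f x = 0.

Definition equivariant (f : M -> N) := forall c x, f (aM c x) = aN c (f x).

Definition equivariantly_homotopic (f0 f1 : M -> N) : Prop :=
  exists H : R -> M -> N,
    [/\ {within `[0, 1]%classic `*` [set: M], continuous (fun z : R * M => H z.1 z.2)},
        forall t, t \in `[0, 1] -> equivariant (H t),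
        H 0 = f0 & H 1 = f1].

Definition holder_le (k : nat) (alpha : R) (A : set 'rV[R]_n)
    (F : 'rV[R]_n -> 'rV[R]_d) (C : R) : Prop :=
  (forall s z, (size s <= k)%N -> A z -> `|partials s F z| <= C) /\
  (forall s z z', size s = k -> A z -> A z' ->
     `|partials s F z - partials s F z'| <= C * `|z - z'| `^ alpha).

Definition holder_at (k : nat) (alpha : R) (F : 'rV[R]_n -> 'rV[R]_d) z : Prop :=
  exists W : set 'rV[R]_n, [/\ open W, W z, Cn k W F &
    exists C, holder_le k alpha W F C].

Definition holder_map k alpha (f : M -> N) : Prop :=
  continuous f /\
  forall x, holder_at k alpha (chart_rep f x) (cmap (chart_at x) x).

(* A section xi of f^*TN has xi x in the tangent space of N at f x; below, its
   coordinates in the charts at q and at f q. *)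
Definition section_rep (f : M -> N) (q : M) (xi : M -> 'rV[R]_d) :
  'rV[R]_n -> 'rV[R]_d :=
  fun z => let x := cinv (chart_at q) z in
           tchange (f x) (f q) (f x) (xi x).

Definition holder_section k alpha (f : M -> N) (xi : M -> 'rV[R]_d) : Prop :=
  forall q, holder_at k alpha (section_rep f q xi) (cmap (chart_at q) q).

Definition equivariant_section (f : M -> N) (xi : M -> 'rV[R]_d) : Prop :=
  forall c x, xi (aM c x) = mdiff (aN c) (f x) (xi x).

(* A finite cover of M on whose pieces Hoelder norms are measured; the
   resulting norms do not depend on it, up to equivalence. *)
Record chart_cover (f : M -> N) := ChartCover {
  cc_size : nat;
  cc_pt : 'I_cc_size -> M;
  cc_set : 'I_cc_size -> set M;
  cc_compact : forall j, compact (cc_set j);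
  cc_dom : forall j, cc_set j `<=` cdom (chart_at (cc_pt j));
  cc_target : forall j, f @` cc_set j `<=` cdom (chart_at (f (cc_pt j)));
  cc_cover : forall x, exists j, (cc_set j)° x
}.
Arguments cc_pt {f} c _ : rename.
Arguments cc_set {f} c _ : rename.

Definition holder_section_le k alpha f (cov : chart_cover f) xi (C : R) : Prop :=
  forall j, holder_le k alpha
    (cmap (chart_at (cc_pt cov j)) @` cc_set cov j)
    (section_rep f (cc_pt cov j) xi) C.

Definition holder_near k alpha f0 (cov : chart_cover f0) (eps : R) (f : M -> N) :
  Prop :=
  forall j, let q := cc_pt cov j in
    f @` cc_set cov j `<=` cdom (chart_at (f0 q)) /\
    holder_le k alpha (cmap (chart_at q) @` cc_set cov j)
      (fun z => cmap (chart_at (f0 q)) (f (cinv (chart_at q) z))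
                - cmap (chart_at (f0 q)) (f0 (cinv (chart_at q) z))) eps.

(* The Banach space of the equivariant C^{k,alpha} sections of f^*TN subject to
   the constraint P, with (up to equivalence) the Hoelder norm; [ss_norm] also
   makes [ss_sec] injective. *)
Record section_space k alpha f (cov : chart_cover f) (P : set (M -> 'rV[R]_d)) :=
  SectionSpace {
  ss_space :> completeNormedModType R;
  ss_sec : ss_space -> M -> 'rV[R]_d;
  ss_linear : forall a u v x, ss_sec (a *: u + v) x = a *: ss_sec u x + ss_sec v x;
  ss_range : range ss_sec =
    [set xi | [/\ holder_section k alpha f xi, equivariant_section f xi & P xi]];
  ss_norm : exists2 C : R, 0 < C & forall v,
    holder_section_le k alpha cov (ss_sec v) (C * `|v|) /\
    forall b, holder_section_le k alpha cov (ss_sec v) b -> `|v| <= C * b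
}.

(* [pr_constraint] collects the endpoint, smoothness and
   normalization conditions on maps, [pr_dom] and [pr_cod] their linearizations
   on the domain and on the codomain of the Jacobi operator. *)
Record probe (k : nat) (alpha : R) (g0 : M -> 'M[R]_n) := Probe {
  pr_metric : N -> 'M[R]_d;
  pr_riemannian : riemannian pr_metric;
  pr_invariant : invariant_metric aN pr_metric;
  pr_constraint : set (M -> N);
  pr_ref : M -> N;
  pr_ref_smooth : msmooth_on setT pr_ref;
  pr_ref_equivariant : equivariant pr_ref;
  pr_ref_constraint : pr_constraint pr_ref;
  pr_ref_harmonic : harmonic g0 pr_metric pr_ref;
  pr_cover : chart_cover pr_ref;
  pr_dom : set (M -> 'rV[R]_d);
  pr_cod : set (M -> 'rV[R]_d);
  pr_E : section_space k.+2 alpha pr_cover pr_dom;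
  pr_F : section_space k alpha pr_cover pr_cod
}.

Definition admissible k alpha g0 (P : probe k alpha g0) (f : M -> N) : Prop :=
  [/\ holder_map k.+2 alpha f, equivariant f,
      equivariantly_homotopic (pr_ref P) f & pr_constraint P f].

(* Local trivializations around the reference map: a chart [lt_map] of the
   space of admissible maps, with values in the space E of sections, whose
   derivative at 0 is the identity, and isomorphisms [lt_iso u x] from the
   tangent space of N at [lt_map u x] to the one at [pr_ref x]. *)
Record local_trivialization k alpha g0 (P : probe k alpha g0) :=
  LocalTrivialization {
  lt_dom : set (pr_E P);
  lt_dom_open : open lt_dom;
  lt_dom0 : lt_dom 0;
  lt_map : pr_E P -> M -> N;
  lt_map0 : lt_map 0 = pr_ref P;
  lt_map_admissible : forall u, lt_dom u -> admissible P (lt_map u);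
  lt_map_inj : forall u v, lt_dom u -> lt_dom v -> lt_map u = lt_map v -> u = v;
  lt_map_velocity : forall u x,
    is_derive (0 : R) 1
      (fun t : R => cmap (chart_at (pr_ref P x)) (lt_map (t *: u) x)) (ss_sec u x);
  lt_map_near : forall eps, 0 < eps ->
    \forall u \near (0 : pr_E P), holder_near k.+2 alpha (pr_cover P) eps (lt_map u);
  lt_map_onto : exists2 eps, 0 < eps & forall f, admissible P f ->
    holder_near k.+2 alpha (pr_cover P) eps f -> exists2 u, lt_dom u & lt_map u = f;
  lt_iso : pr_E P -> M -> 'M[R]_d;
  lt_iso0 : forall x, lt_iso 0 x = 1%:M;
  lt_iso_unit : forall u x, lt_dom u -> lt_iso u x \in unitmx
}.

End maps_to_target.

Section core_package.
Context {R : realType} {m n d l : nat} {S : smooth_manifold (R := R) m}.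
Context {M : smooth_manifold (R := R) n} {N : smooth_manifold (R := R) d}.
Context {K : lie_group (R := R) l} {aM : lie_action K M} {aN : lie_action K N}.
Context {k : nat} {alpha : R} {g0 : M -> 'M[R]_n}.

(* The harmonic maps f_p = lt_map (cp_param p) and the linearized tension
   field, read in the fixed trivializations. *)
Record core_package (P : probe aM aN k alpha g0) (T : local_trivialization P)
    (g : S -> M -> 'M[R]_n) := CorePackage {
  cp_tension : S -> pr_E P -> pr_F P;
  cp_tensionE : forall p u x, lt_dom T u ->
    ss_sec (cp_tension p u) x
    = tension (g p) (pr_metric P) (lt_map T u) x *m lt_iso T u x;
  cp_param : S -> pr_E P;
  cp_param_smooth : msmooth_on (M2 := flat (pr_E P)) setT cp_param;
  cp_param_dom : forall p, lt_dom T (cp_param p);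
  cp_harmonic : forall p, harmonic (g p) (pr_metric P) (lt_map T (cp_param p));
  cp_unique : forall p u, lt_dom T u ->
    harmonic (g p) (pr_metric P) (lt_map T u) -> u = cp_param p;
  cp_J : S -> bop (pr_E P) (pr_F P);
  cp_tension_diff : forall p, differentiable (cp_tension p) (cp_param p);
  cp_J_diff : forall p u, cp_J p u = 'd (cp_tension p) (cp_param p) u;
  cp_G : S -> bop (pr_F P) (pr_E P);
  cp_JK : forall p, cancel (cp_J p) (cp_G p);
  cp_GK : forall p, cancel (cp_G p) (cp_J p);
  cp_smooth : msmooth_on
    (M2 := flat (bop (pr_E P) (pr_F P) * bop (pr_F P) (pr_E P))%type) setT
    (fun p => (cp_J p, cp_G p))
}.

Variables (P : probe aM aN k alpha g0) (T : local_trivialization P).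
Variable g : S -> M -> 'M[R]_n.

Definition core_space : normedModType R :=
  (bop (pr_E P) (pr_F P) * bop (pr_F P) (pr_E P))%type.

Definition core_map (C : core_package T g) (p : S) : flat core_space :=
  (cp_J C p, cp_G C p).

Definition response_differential (C : core_package T g) (p0 : S) :
  'rV[R]_m -> core_space := mdiff (core_map C) p0.

Definition joint_observation (C : core_package T g)
  (psi : 'I_m -> core_space -> R) (p : S) : flat 'rV[R]_m :=
  \row_(i < m) psi i (core_map C p).

End core_package.

(* Main.v *)
Require Import Defs.
From HB Require Import structures.
From mathcomp Require Import all_boot all_order all_algebra.
From mathcomp Require Import all_classical all_reals all_analysis.
From mathcomp Require Import ring lra.
Import Order.TTheory GRing.Theory Num.Theory.
Import numFieldNormedType.Exports.
Local Open Scope classical_set_scope.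
Local Open Scope ring_scope.

(** Point evaluations of sections, taken in the charts of the cover that defines
    the Hoelder norm, are bounded functionals that separate the points of the
    section spaces; applied to images [A u] they give bounded functionals
    separating the points of the space of operator pairs. Since the response
    differential D is injective, m of their linear combinations can therefore be
    chosen dual to D, i.e. with psi_i (D v) = v_i. The joint observation then has
    the identity as its differential at p0, and the inverse function theorem
    applies. *)

(** * Smooth maps between normed spaces *)

Section smooth_calculus.
Set Implicit Arguments.
Unset Strict Implicit.
Variable R : realType.
Implicit Types E F H : normedModType R.

Lemma open_setX (X Y : topologicalType) (A : set X) (B : set Y) :
  open A -> open B -> open (A `*` B).
Proof.
move=> oA oB; rewrite openE => -[a b] [/= Aa Bb].
by exists (A, B); [split; exact: open_nbhs_nbhs|case=> x y []].
Qed.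

Lemma diff_near E F (f : E -> F) (x : E) (e : R) :
  differentiable f x -> 0 < e ->
  \forall y \near x, `|f y - f x - 'd f x (y - x)| <= e * `|y - x|.
Proof.
move=> /diff_locally/eqaddoP/[apply] fe; rewrite (near_shift 0 x) /=; apply: filterS fe => y /=.
by rewrite /cst /= subr0 addrK opprD addrA.
Qed.

(** The estimate says that the remainder is little-o, and a continuous linear map with this property
    is the differential by uniqueness. With [diff_near], this allows arguing with explicit
    bounds. *)
Lemma near_diff E F (f : E -> F) (x : E) (L : {linear E -> F}) :
  continuous L ->
  (forall e : R, 0 < e ->
    \forall y \near x, `|f y - f x - L (y - x)| <= e * `|y - x|) ->
  differentiable f x /\ 'd f x = L :> (E -> F).
Proof.
move=> cL fL; have fxL : f \o shift x = cst (f x) + L +o_ 0 id.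
  apply/eqaddoP => e /fL; rewrite (near_shift 0 x) /=; apply: filterS => y /=.
  by rewrite /cst /= subr0 addrK opprD addrA.
have dL := diff_unique cL fxL; split=> //.
by apply/diff_locallyP; rewrite dL.
Qed.

Lemma Cn_sub n E F (U V : set E) (f : E -> F) :
  V `<=` U -> Cn n U f -> Cn n V f.
Proof.
elim: n E F U V f => [|n IHn] E F U V f VU /=; first by move=> fU x /VU /fU.
case=> fU dfU; split; first by move=> x /VU /fU.
by apply: IHn dfU => -[x v] [/= /VU Ux _].
Qed.

Lemma near_eq_diff E F (f g : E -> F) (x : E) :
  (\forall y \near x, f y = g y) -> differentiable f x ->
  differentiable g x /\ 'd g x = 'd f x :> (E -> F).
Proof.
move=> fg df; apply: (near_diff (L := 'd f x)) => [|e e0].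
  exact: diff_continuous.
near=> y; have <- : f y = g y by near: y.
by rewrite -(nbhs_singleton fg); near: y; exact: diff_near.
Unshelve. all: by end_near.
Qed.

(** On an open set the two maps agree near each point, so their differentials agree too. Later
    inductions use this to replace the differential of a pair or a composite by its formula. *)
Lemma Cn_ext n E F (U : set E) (f g : E -> F) :
  open U -> (forall x, U x -> f x = g x) -> Cn n U f -> Cn n U g.
Proof.
elim: n E F U f g => [|n IHn] E F U f g oU fg /=.
  move=> fU x Ux; have := fU x Ux; rewrite /prop_for/continuous_at (fg x)//.
  apply: cvg_trans; apply: near_eq_cvg; near=> y; rewrite fg//.
  by near: y; exact: open_nbhs_nbhs.
case=> fU dfU.
have dfg x : U x -> differentiable g x /\ 'd g x = 'd f x :> (E -> F).
  move=> Ux; apply: near_eq_diff (fU _ Ux); near=> y; apply: fg.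
  by near: y; exact: open_nbhs_nbhs.
split=> [x /dfg[]//|]; apply: IHn dfU; first by apply: open_setX => //; exact: openT.
by move=> -[x v] [/= /dfg[_ ->]].
Unshelve. all: by end_near. Qed.

Lemma Cn_pair n E F H (U : set E) (f : E -> F) (g : E -> H) : open U ->
  Cn n U f -> Cn n U g -> Cn n U (fun x => (f x, g x)).
Proof.
elim: n E F H U f g => [|n IHn] E F H U f g oU /=.
  by move=> fU gU x Ux; apply: cvg_pair; [exact: fU|exact: gU].
move=> [fU dfU] [gU dgU]; split=> [x Ux|].
  by apply: differentiable_pair; [exact: fU|exact: gU].
have oUT : open (U `*` [set: E]) by apply: open_setX => //; exact: openT.
apply: Cn_ext (IHn _ _ _ _ _ _ oUT dfU dgU) => // -[x v] [/= Ux _].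
by rewrite (diff_pair (fU _ Ux) (gU _ Ux)).
Qed.

(** The tangent map of a continuous linear [L] is again linear, namely [L] on both components, so
    the class of inner maps is stable under the induction. The case of [fst] is used for tangent
    maps, before general composites. *)
Lemma Cn_comp_linear n E F H (U : set E) (V : set F) (L : {linear E -> F})
    (f : F -> H) : open U -> continuous L -> (forall x, U x -> V (L x)) ->
  Cn n V f -> Cn n U (f \o L).
Proof.
elim: n E F H U V L f => [|n IHn] E F H U V L f oU cL UV /=.
  by move=> fV x Ux; apply: continuous_comp; [exact: cL|exact/fV/UV].
move=> [fV dfV]; split=> [x Ux|].
  by apply: differentiable_comp; [exact: linear_differentiable|exact/fV/UV].
have oUT : open (U `*` [set: E]) by apply: open_setX => //; exact: openT.
have LL : linear (fun z : E * E => (L z.1, L z.2)).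
  by move=> a [u1 u2] [v1 v2] /=; rewrite !linearP.
pose L2 : {linear (E * E)%type -> (F * F)%type} := HB.pack (fun z : E * E => (L z.1, L z.2))
  (GRing.isLinear.Build R _ _ _ _ LL).
have cL2 : continuous L2.
  move=> z; apply: cvg_pair; apply: continuous_comp; try exact: cL.
    exact: cvg_fst.
  exact: cvg_snd.
apply: Cn_ext (IHn _ _ _ _ (V `*` [set: F]) L2 _ oUT cL2 _ dfV) => //.
  move=> [x v] [/= Ux _]; have dL : differentiable L x by exact: linear_differentiable.
  by rewrite (diff_comp dL (fV _ (UV _ Ux))) /= (diff_lin x cL).
by move=> [x v] [/= Ux _]; split=> //; exact: UV.
Qed.

Lemma Cn_linear_comp n E F H (U : set E) (f : E -> F) (L : {linear F -> H}) :
  open U -> continuous L -> Cn n U f -> Cn n U (L \o f).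
Proof.
elim: n E F H U f L => [|n IHn] E F H U f L oU cL /=.
  by move=> fU x Ux; apply: continuous_comp; [exact: fU|exact: cL].
have dL x : differentiable L x by exact: linear_differentiable.
move=> [fU dfU]; split=> [x Ux|]; first exact: differentiable_comp (fU _ Ux) _.
have oUT : open (U `*` [set: E]) by apply: open_setX => //; exact: openT.
apply: Cn_ext (IHn _ _ _ _ _ L oUT cL dfU) => // -[x v] [/= Ux _].
by rewrite (diff_comp (fU _ Ux) (dL _)) /= (diff_lin _ cL).
Qed.

Lemma smooth_diff E F (U : set E) (f : E -> F) :
  smooth_on U f -> smooth_on (U `*` [set: E]) (fun z : E * E => 'd f (z.1) (z.2)).
Proof. by move=> sf n; have [] := sf n.+1. Qed.

Lemma smooth_differentiable E F (U : set E) (f : E -> F) x :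
  smooth_on U f -> U x -> differentiable f x.
Proof. by move=> /(_ 1%N)[+ _] => /[apply]. Qed.

Definition tangent_map E F (f : E -> F) (z : E * E) : F * F :=
  (f z.1, 'd f (z.1) (z.2)).

Lemma smooth_tangent E F (U : set E) (f : E -> F) : open U ->
  smooth_on U f -> smooth_on (U `*` [set: E]) (tangent_map f).
Proof.
move=> oU sf n; have oUT : open (U `*` [set: E]).
  by apply: open_setX => //; exact: openT.
apply: Cn_pair => //; last exact: smooth_diff.
by apply: (@Cn_comp_linear n _ _ _ _ U fst) => //;
  [move=> z; exact: cvg_fst|case=> ? ? []].
Qed.

(** By the chain rule the differential of the composite is ['d g] after [tangent_map f], again a
    composite of smooth maps; hence the induction on the order, with all spaces and maps
    generalized. *)
Lemma smooth_comp E F H (U : set E) (V : set F) (f : E -> F) (g : F -> H) :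
  open U -> (forall x, U x -> V (f x)) -> smooth_on U f -> smooth_on V g ->
  smooth_on U (g \o f).
Proof.
move=> oU UV sf sg n; elim: n E F H U V f g oU UV sf sg =>
    [|n IHn] E F H U V f g oU UV sf sg /=.
  move=> x Ux; apply: continuous_comp; first exact: (sf 0%N).
  exact/(sg 0%N)/UV.
split=> [x Ux|].
  apply: differentiable_comp; first exact: smooth_differentiable sf Ux.
  exact: smooth_differentiable sg (UV _ Ux).
have oUT : open (U `*` [set: E]) by apply: open_setX => //; exact: openT.
apply: Cn_ext (IHn _ _ _ _ (V `*` [set: F]) (tangent_map f) _ oUT _
  (smooth_tangent oU sf) (smooth_diff sg)) => //.
  move=> [x v] [/= Ux _]; 
  by rewrite (diff_comp (smooth_differentiable sf Ux)
    (smooth_differentiable sg (UV _ Ux))).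
by move=> [x v] [/= Ux _]; split=> //; exact: UV.
Qed.

End smooth_calculus.

(** * Smoothness of a continuous right inverse *)

Section smooth_inverse.
Set Implicit Arguments.
Unset Strict Implicit.
Variable R : realType.
Implicit Types E F : normedModType R.

Lemma le_norm_pair E F (z : E * F) (c : R) :
  `|z.1| <= c -> `|z.2| <= c -> `|z| <= c.
Proof. by case: z => a b /= ac bc; rewrite prod_normE ge_max ac. Qed.

(** The lower bound makes [A] injective, so a choice of preimages is linear; the same bound controls
    its norm. *)
Lemma bounded_inverse E F (A : {linear E -> F}) (C : R) :
  (forall w, exists v, A v = w) -> (forall v, `|v| <= C * `|A v|) ->
  exists L : {linear F -> E},
    [/\ continuous L, forall w, A (L w) = w & forall w, `|L w| <= C * `|w|].
Proof.
move=> sA bA; have [L0 L0E] := choice sA.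
have Ainj v w : A v = A w -> v = w.
  move=> vw; apply/eqP; rewrite -subr_eq0 -normr_le0.
  by rewrite (le_trans (bA _))// linearB vw /= subrr normr0 mulr0.
have lL : linear L0 by move=> a u v; apply: Ainj; rewrite linearP !L0E.
pose L : {linear F -> E} := HB.pack L0 (GRing.isLinear.Build R F E _ _ lL).
have bL w : `|L w| <= C * `|w| by rewrite -{2}(L0E w) bA.
exists L; split=> //; apply: bounded_linear_continuous.
apply/linear_boundedP; near=> r => x; rewrite (le_trans (bL _))//.
by rewrite ler_wpM2r//; near: r; apply: nbhs_pinfty_ge; rewrite num_real.
Unshelve. all: by end_near.
Qed.

(** The constant is uniform near each point: this is what bounds the inverse differentials locally,
    and what passes on to the tangent map. *)
Definition locally_bounded_below E F (U : set E) (f : E -> F) :=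
  forall x, U x -> exists2 C : R, 0 < C &
    \forall y \near x, forall v, `|v| <= C * `|'d f y v|.

(** Expand [f] to first order at [g y] along [g z], where [f (g z) - f (g y)] is [z - y], and apply
    the inverse of ['d f (g y)]. *)
Lemma differentiable_inverse E F (f : E -> F) (g : F -> E) (y : F) (C : R) :
  {for y, continuous g} -> (\forall z \near y, f (g z) = z) ->
  differentiable f (g y) -> (forall w, exists v, 'd f (g y) v = w) -> 0 < C ->
  (forall v, `|v| <= C * `|'d f (g y) v|) ->
  differentiable g y.
Proof.
move=> cg fg df sA C0 bA; have [L [cL AL bL]] := bounded_inverse sA bA.
suff : differentiable g y /\ 'd g y = L :> (F -> E) by case.
apply: near_diff => // e e0.
have fgy : f (g y) = y by exact: nbhs_singleton fg.
(* The first bound gives [C * d <= 1/2], so that the remainder can be absorbed and [g] satisfies a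
   Lipschitz estimate at [y] with constant [2 * C]. The second turns the final error
   [d * (2 * C ^+ 2)] into at most [e]. *)
pose d := Num.min (2 * C)^-1 (e / (2 * C ^+ 2)).
have d0 : 0 < d.
  by rewrite lt_min invr_gt0 divr_gt0 ?mulr_gt0 ?exprn_gt0// ltr0n.
have := cg _ (diff_near df d0).
rewrite /= => near_g; near=> z.
have fgz : f (g z) = z by near: z.
have : `|f (g z) - f (g y) - 'd f (g y) (g z - g y)| <= d * `|g z - g y|.
  by near: z.
rewrite fgz fgy; set A := 'd f (g y) => fz.
have h1 : `|g z - g y| <= 2 * C * `|z - y|.
  have : `|g z - g y| <= C * `|z - y| + C * (d * `|g z - g y|).
    rewrite (le_trans (bA _))// -mulrDr ler_pM2l// -[X in `|X|](subrK (z - y)).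
    by rewrite addrC (le_trans (ler_normD _ _))// lerD2l distrC.
  have : C * d <= 2^-1.
    rewrite -ler_pdivlMl// mulrC -invfM mulrC [C * 2]mulrC.
    by rewrite ge_min lexx.
  have := normr_ge0 (g z - g y); nra.
have -> : g z - g y - L (z - y) = L (A (g z - g y) - (z - y)).
  have AI u v : A u = A v -> u = v.
    move=> uv; apply/eqP; rewrite -subr_eq0 -normr_le0.
    by rewrite (le_trans (bA _))// linearB uv /= subrr normr0 mulr0.
  by apply: AI; rewrite AL linearB AL.
rewrite (le_trans (bL _))// distrC (le_trans (ler_wpM2l (ltW C0) fz))//.
have : d <= e / (2 * C ^+ 2) by rewrite ge_min lexx orbT.
rewrite ler_pdivlMr ?mulr_gt0 ?exprn_gt0// => de.
rewrite (@le_trans _ _ (C * (d * (2 * C * `|z - y|))))//.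
  by rewrite ler_pM2l// ler_pM2l.
rewrite (_ : C * _ = d * (2 * C ^+ 2) * `|z - y|); last by ring.
by rewrite ler_wpM2r.
Unshelve. all: by end_near.
Qed.

(** The differential of the tangent map is block triangular, with ['d f x] twice on the diagonal and
    a second derivative of [f] off it. Surjectivity and lower bounds can therefore be lifted from
    [f] to [tangent_map f]. *)
Lemma diff_tangent E F (U : set E) (f : E -> F) (x v a b : E) :
  smooth_on U f -> U x ->
  'd (tangent_map f) (x, v) (a, b) =
  ('d f x a, 'd (fun z : E * E => 'd f (z.1) (z.2)) (x, v) (a, 0) + 'd f x b).
Proof.
move=> sf Ux; have df := smooth_differentiable sf Ux.
have cfst : continuous (fst : E * E -> E) by move=> z; exact: cvg_fst.
have dfst : differentiable (fst : E * E -> E) (x, v).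
  exact: linear_differentiable.
have df1 : differentiable (f \o fst) (x, v) by exact: differentiable_comp.
have ddf : differentiable (fun z : E * E => 'd f (z.1) (z.2)) (x, v).
  exact: (smooth_differentiable (smooth_diff sf)).
rewrite (diff_pair df1 ddf) (diff_comp dfst df) /= (diff_lin (x, v) cfst) /=.
congr pair; rewrite (_ : (a, b) = (a, 0) + (0, b)); last first.
  by rewrite /GRing.add /= /add_pair /= addr0 add0r.
rewrite linearD; congr (_ + _).
(* With [x] fixed, the map [w |-> 'd f x w] is continuous and linear, hence its own differential. *)
have dp : differentiable (fun w : E => (x, w)) v by exact: differentiable_pair.
have := diff_comp dp ddf; rewrite (diff_pair (differentiable_cst _ _) _)//.
rewrite diff_cst diff_val => /(congr1 (fun h => h b)) /= <-.
by rewrite -[RHS](congr1 (@^~ b) (diff_lin v (diff_continuous df))).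
Qed.

(* Joint continuity of [(y, v) |-> 'd f y v] at [(x, 0)] bounds the operators
   ['d f y] uniformly near [x]. *)
Lemma diff_bounded_near E F (U : set E) (f : E -> F) x : smooth_on U f -> U x ->
  exists2 C : R, 0 < C & \forall y \near x, forall v, `|'d f y v| <= C * `|v|.
Proof.
move=> sf Ux; have : {for (x, 0), continuous (fun z : E * E => 'd f (z.1) (z.2))}.
  exact: (smooth_diff sf 0%N).
rewrite /prop_for/continuous_at /= linear0 => /cvgr0_norm_le /(_ _ ltr01).
case=> -[A B] /= [nA /nbhs_norm0P[e /= e0 eB]] AB; exists (2 / e).
  by rewrite divr_gt0.
apply: filterS nA => y Ay v.
have [->|v0] := eqVneq v 0; first by rewrite linear0 !normr0 mulr0.
have nv : 0 < `|v| by rewrite normr_gt0.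
(* Rescaling [v] to length [e / 2] brings it into the ball where the values have norm at most 1,
   whence the constant [2 / e]. *)
have : `|'d f y ((e / 2 / `|v|) *: v)| <= 1.
  apply: (AB (y, _)); split=> //=; apply: eB => /=.
  rewrite normrZ gtr0_norm ?divr_gt0// divfK ?gt_eqF//.
  by rewrite ltr_pdivrMr// ltr_pMr// ltr1n.
rewrite linearZ normrZ gtr0_norm ?divr_gt0// -ler_pdivlMl ?divr_gt0// mulr1.
by rewrite !invf_div [X in _ <= X]mulrC.
Qed.

(* The tangent map of [g] is the inverse of the tangent map of [f], which
   satisfies the same hypotheses: this is the induction on [n]. *)
Lemma Cn_inverse n E F (U : set E) (W : set F) (f : E -> F) (g : F -> E) :
  open U -> open W -> smooth_on U f ->
  (forall y, W y -> U (g y)) -> (forall y, W y -> f (g y) = y) ->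
  (forall y, W y -> {for y, continuous g}) ->
  (forall x w, U x -> exists v, 'd f x v = w) -> locally_bounded_below U f ->
  Cn n W g.
Proof.
elim: n E F U W f g => [|n IHn] E F U W f g oU oW sf WU fg cg surj bnd //.
have dg y : W y -> differentiable g y.
  move=> Wy; have [C C0 /nbhs_singleton bC] := bnd _ (WU _ Wy).
  apply: (differentiable_inverse _ _ _ _ C0 bC) => //.
  - exact: cg.
  - by near=> z; apply: fg; near: z; exact: open_nbhs_nbhs.
  - exact: smooth_differentiable sf (WU _ Wy).
  - by move=> w; exact: surj (WU _ Wy).
have dfg y w : W y -> 'd f (g y) ('d g y w) = w.
  move=> Wy; have := diff_comp (dg _ Wy) (smooth_differentiable sf (WU _ Wy)).
  have [| |_ ->] := @near_eq_diff R _ _ id (f \o g) y.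
  - by near=> z; rewrite /= fg//; near: z; exact: open_nbhs_nbhs.
  - by [].
  - by rewrite diff_val => /(congr1 (fun h => h w)) /= <-.
have bddf := diff_bounded_near (smooth_diff sf).
have cdg y w : W y -> {for (y, w), continuous (fun z : F * F => 'd g (z.1) (z.2))}.
  move=> Wy; have [C C0 bC] := bnd _ (WU _ Wy).
  apply/cvgrPdist_le => /= e e0.
  (* By the lower bound at [g y'], the distance from ['d g y' w'] to [a] is at most [C] times the
     norm of [w' - 'd f (g y') a], which is continuous in [(y', w')] and vanishes at [(y, w)]. *)
  pose a := 'd g y w.
  have cdf : {for (y, w), continuous
      (fun z : F * F => z.2 - 'd f (g z.1) a)}.
    apply: (@continuousB _ _ _ _ (fun z : F * F => 'd f (g z.1) a)).
      exact: cvg_snd.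
    apply: (@continuous_comp _ _ _ (fun z : F * F => (g z.1, a))
      (fun z : E * E => 'd f (z.1) (z.2))).
      apply: cvg_pair; last exact: cvg_cst.
      by apply: continuous_comp; [exact: cvg_fst|exact: cg].
    have : (U `*` [set: E]) (g y, a) by split=> //; exact: WU.
    by move=> /(smooth_diff sf 0%N).
  have : \forall z \near (y, w), `|(z : F * F).2 - 'd f (g z.1) a| <= C^-1 * e.
    move: cdf; rewrite /prop_for/continuous_at /= dfg// subrr.
    by move=> /cvgr0_norm_le; apply; rewrite mulr_gt0 ?invr_gt0.
  have : \forall z \near (y, w), W (z : F * F).1.
    by apply: cvg_fst; exact: open_nbhs_nbhs.
  have : \forall z \near (y, w), forall v, `|v| <= C * `|'d f (g (z : F * F).1) v|.
    exact: (@cvg_fst _ _ (nbhs y) (nbhs w) _ _ (cg _ Wy _ bC)).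
  apply: filterS3 => -[y' w'] /= bC' Wy'.
  rewrite ler_pdivlMl// => le; rewrite distrC (le_trans (bC' _))// linearB /=.
  by rewrite dfg.
split=> //; have oUT : open (U `*` [set: E]) by apply: open_setX; last exact: openT.
have oWT : open (W `*` [set: F]) by apply: open_setX; last exact: openT.
(* The differential of [g] is the second component of its tangent map, to which the induction
   hypothesis applies. *)
suff : Cn n (W `*` [set: F]) (tangent_map g).
  move=> cT; apply: (@Cn_linear_comp _ _ _ _ _ _ _ snd oWT _ cT).
  by move=> z; exact: cvg_snd.
apply: (IHn _ _ _ _ (tangent_map f) (tangent_map g) oUT oWT).
- exact: smooth_tangent.
- by move=> [y w] [/= Wy _]; split=> //; exact: WU.
- by move=> [y w] [/= Wy _]; rewrite /tangent_map/= fg// dfg.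
- move=> [y w] [/= Wy _]; apply: cvg_pair; last exact: cdg.
  by apply: continuous_comp; [exact: cvg_fst|exact: cg].
(* The triangular system is solved first for [a], then for [b]. *)
- move=> [x v] [w1 w2] [/= Ux _]; have [a ax] := surj x w1 Ux.
  have [b bx] := surj x (w2 - 'd (fun z : E * E => 'd f (z.1) (z.2)) (x, v) (a, 0)) Ux.
  by exists (a, b); rewrite (diff_tangent _ _ _ sf Ux) ax bx addrC subrK.
move=> [x v] [/= Ux _]; have [C C0 bC] := bnd x Ux.
have [K K0 bK] := bddf (x, v) (conj Ux I).
(* The first summand bounds [a]; the second bounds [b], where [K * C] accounts for the off-diagonal
   term. The sum dominates both. *)
exists (C + C * (1 + K * C)) => [|]; first by rewrite addr_gt0// mulr_gt0// addr_gt0// mulr_gt0.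
have : \forall z \near (x, v), forall v, `|v| <= C * `|'d f ((z : E * E).1) v|.
  exact: (@cvg_fst _ _ (nbhs x) (nbhs v) _ _ bC).
have : \forall z \near (x, v), U (z : E * E).1.
  by apply: cvg_fst; exact: open_nbhs_nbhs.
apply: filterS3 bK => -[x' v'] /= bK Ux' bC' [a b].
rewrite (diff_tangent _ _ _ sf Ux').
set p := 'd _ _ (a, 0); set w := ('d f x' a, _).
have w1 : `|'d f x' a| <= `|w| by rewrite prod_normE le_max /= lexx.
have w2 : `|p + 'd f x' b| <= `|w| by rewrite prod_normE le_max /= lexx orbT.
have na : `|a| <= C * `|w| by rewrite (le_trans (bC' _))// ler_pM2l.
have np : `|p| <= K * `|a|.
  rewrite (le_trans (bK _))// ler_pM2l//; apply: le_norm_pair => //=.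
  by rewrite normr0.
have nb : `|b| <= C * (`|w| + K * (C * `|w|)).
  rewrite (le_trans (bC' _))// ler_pM2l// -[X in `|X|](addKr p) addrC.
  rewrite (le_trans (ler_normB _ _))// lerD// (le_trans np)// ler_pM2l//.
have w0 := normr_ge0 w.
apply: le_norm_pair => /=.
  rewrite (le_trans na)// ler_wpM2r// lerDl mulr_ge0// ?ltW// addr_gt0// mulr_gt0//.
rewrite (le_trans nb)// (_ : C * _ = C * (1 + K * C) * `|w|); last by ring.
by rewrite ler_wpM2r// lerDr ltW.
Unshelve. all: by end_near.
Qed.

End smooth_inverse.

(** * The inverse function theorem *)

(** Completeness of row vectors is what the Banach fixed point theorem asks for. *)
HB.instance Definition _ (R : realType) (m : nat) :=
  Uniform_isComplete.Build 'rV[R]_m (@cauchy_cvg _).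

Section inverse_function_theorem.
Set Implicit Arguments.
Unset Strict Implicit.
Variable R : realType.

(* Fixed point of the contraction [x |-> x - (h x - y)]. *)
Lemma near_identity_onto (X : completeNormedModType R) (h : X -> X) (x0 y : X)
    (r : R) : 0 <= r ->
  (forall x x', `|x - x0| <= r -> `|x' - x0| <= r ->
    `|h x - h x' - (x - x')| <= 2^-1 * `|x - x'|) ->
  `|y - h x0| <= 2^-1 * r -> exists2 x, `|x - x0| <= r & h x = y.
Proof.
move=> r0 hid yh; pose B := [set x : X | `|x - x0| <= r].
pose T (x : X) := x - (h x - y).
have TE x x' : T x - T x' = - (h x - h x' - (x - x')).
  rewrite /T [RHS]opprB (opprD x') addrACA -opprD; congr (_ - _).
  by rewrite opprB addrA subrK.
(* [T] moves the centre by at most [r / 2] and halves distances, so it maps the ball into itself. *)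
have TB : set_fun B B T.
  move=> x Bx; rewrite /B /= -[T x - x0](subrK (T x0 - x0)).
  rewrite (_ : T x - x0 - _ = T x - T x0); last by rewrite opprB addrA subrK.
  rewrite TE (le_trans (ler_normD _ _))// normrN.
  have B0 : `|x0 - x0| <= r by rewrite subrr normr0.
  have := hid _ _ Bx B0; have : `|T x0 - x0| <= 2^-1 * r.
    by rewrite /T addrAC subrr add0r opprB.
  move: Bx; rewrite /B /=; lra.
pose TF : {fun B >-> B} := HB.pack T (isFun.Build X X B B T TB).
have cT : is_contraction TF.
  exists (2^-1%:nng); split; first by rewrite /= invf_lt1 ?ltr1n.
  by move=> [x x'] [/= Bx Bx']; rewrite TE normrN; exact: hid.
have clB : closed B.
  have -> : B = (fun x => `|x - x0|) @^-1` [set t | t <= r] by [].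
  apply: closed_comp; last exact: closed_le.
  move=> x _; apply: (@continuous_comp _ _ _ (fun x => x - x0) (@Num.norm R X)); last exact: norm_continuous.
  by apply: continuousB; [exact: cvg_id|exact: cvg_cst].
have [|x Bx xT] := banach_fixed_point cT clB.
  by exists x0; rewrite /B /= subrr normr0.
exists x => //; apply/eqP; rewrite -subr_eq0; apply/eqP.
by have /eqP := xT; rewrite /= /T eq_sym addrC -subr_eq0 addrK oppr_eq0 => /eqP.
Qed.

Lemma coord_le_norm m (v : 'rV[R]_m) i : `|v 0 i| <= `|v|.
Proof.
rewrite [leRHS]mx_normrE.
exact: (le_bigmax _ (fun ij : 'I_1 * 'I_m => `|v ij.1 ij.2|) (0, i)).
Qed.

Lemma norm_le_coord m (v : 'rV[R]_m) (c : R) :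
  0 <= c -> (forall i, `|v 0 i| <= c) -> `|v| <= c.
Proof.
move=> c0 vc; rewrite [leLHS]mx_normrE.
by apply/bigmax_leP; split=> // -[i j] _ /=; rewrite ord1.
Qed.

(** The one-variable mean value theorem is applied to each coordinate along the segment, which stays
    in the ball by convexity. The norm of a row is the maximum of its entries, so no factor
    depending on [m] appears. *)
Lemma mean_value_rV (E : normedModType R) m (h : E -> 'rV[R]_m) (x0 : E) (r e : R) :
  0 <= e ->
  (forall x, `|x - x0| < r -> differentiable h x) ->
  (forall x v, `|x - x0| < r -> `|'d h x v| <= e * `|v|) ->
  forall x y, `|x - x0| < r -> `|y - x0| < r -> `|h x - h y| <= e * `|x - y|.
Proof.
move=> e0 dh bh x y xr yr; apply: norm_le_coord => [|i]; first exact: mulr_ge0.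
pose c (t : R) := y + t *: (x - y).
have cr t : t \in `[0, 1] -> `|c t - x0| < r.
  rewrite in_itv /= => /andP[t0 t1].
  have -> : c t - x0 = t *: (x - x0) + (1 - t) *: (y - x0).
    rewrite /c scalerBl scale1r addrAC [RHS]addrCA -scalerBr.
    by rewrite (opprB y) addrA subrK.
  rewrite (le_lt_trans (ler_normD _ _))// !normrZ !ger0_norm ?subr_ge0//.
  apply: (@le_lt_trans _ _ (Num.max `|x - x0| `|y - x0|)); last by rewrite gt_max xr.
  have : `|x - x0| <= Num.max `|x - x0| `|y - x0| by rewrite le_max lexx.
  have : `|y - x0| <= Num.max `|x - x0| `|y - x0| by rewrite le_max lexx orbT.
  nra.
pose phi (t : R) : R := h (c t) 0 i.
have lco : linear (fun N : 'rV[R]_m => N 0 i : R) by move=> a u v; rewrite !mxE.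
pose co : {linear 'rV[R]_m -> R} := HB.pack (fun N : 'rV[R]_m => N 0 i : R)
  (GRing.isLinear.Build R _ R _ _ lco).
have cco : continuous co by exact: coord_continuous.
have dphi (t : R) : t \in `[0, 1] -> is_derive t 1 phi ('d h (c t) (x - y) 0 i).
  move=> t01.
  have dc : is_diff t c (0 + *:%R^~ (x - y)) by apply: is_diffD.
  have dhc : is_diff (c t) h ('d h (c t)) by apply/differentiableP/dh/cr.
  have dhct := is_diff_comp dc dhc.
  have dco : differentiable co ((h \o c) t) by exact: linear_differentiable.
  have dphit : differentiable phi t by exact: differentiable_comp dco.
  apply: DeriveDef; first exact: diff_derivable.
  rewrite deriveE// (diff_comp (ex_diff (is_diff_def := dhct)) dco) /=.
  by rewrite (diff_lin _ cco) diff_val /= add0r scale1r.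
pose dphi_val (t : R) : R := 'd h (c t) (x - y) 0 i.
have dphio (t : R) : t \in `]0, 1[ -> is_derive t 1 phi (dphi_val t).
  by move/subset_itv_oo_cc; exact: dphi.
have cphi : {within `[0, 1], continuous phi}.
  apply: derivable_within_continuous => t /dphi ht; exact: ex_derive.
have [t t01] := MVT_segment ler01 dphio cphi.
rewrite /dphi_val subr0 mulr1 /phi /c scale1r scale0r addr0 [y + _]addrC subrK => phiE.
rewrite !mxE phiE (le_trans (coord_le_norm _ _))//.
by apply: bh; exact: cr.
Qed.

Lemma linear_row_sum m (V : lmodType R) (f : {linear 'rV[R]_m -> V}) v :
  f v = \sum_(j < m) v 0 j *: f (delta_mx 0 j).
Proof.
rewrite [in LHS](row_sum_delta v) linear_sum.
by apply: eq_bigr => j _; rewrite linearZ.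
Qed.

(** Joint continuity gives closeness on each of the finitely many basis vectors, and linearity
    spreads it to all [v]. *)
Lemma diff_close_near m n (f : 'rV[R]_m -> 'rV[R]_n) (U : set 'rV[R]_m) x0 (e : R) :
  smooth_on U f -> U x0 -> 0 < e ->
  \forall x \near x0, forall v, `|'d f x v - 'd f x0 v| <= e * `|v|.
Proof.
move=> sf Ux0 e0; pose e' := e / m.+1%:R.
have e'0 : 0 < e' by rewrite divr_gt0.
have close (j : 'I_m) : \forall x \near x0,
    `|'d f x0 (delta_mx 0 j) - 'd f x (delta_mx 0 j)| <= e'.
  have cdf : {for x0, continuous (fun x => 'd f x (delta_mx 0 j))}.
    apply: (@continuous_comp _ _ _ (fun x => (x, delta_mx 0 j : 'rV[R]_m))
      (fun z : 'rV[R]_m * 'rV[R]_m => 'd f (z.1) (z.2))).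
      by apply: differentiable_continuous; exact: differentiable_pair.
    have : (U `*` [set: 'rV[R]_m]) (x0, delta_mx 0 j) by split.
    by move=> /(smooth_diff sf 0%N).
  have c : 'd f x (delta_mx 0 j) @[x --> x0] --> 'd f x0 (delta_mx 0 j) by exact: cdf.
  by move/cvgrPdist_le : c => /(_ _ e'0).
have closes : \forall x \near x0, forall j : 'I_m,
    `|'d f x0 (delta_mx 0 j) - 'd f x (delta_mx 0 j)| <= e'.
  have := @filter_forall _ _ (fun (j : 'I_m) x =>
    `|'d f x0 (delta_mx 0 j) - 'd f x (delta_mx 0 j)| <= e') (nbhs x0) (nbhs_filter x0) close.
  by [].
near=> x => v.
have xe (j : 'I_m) : `|'d f x0 (delta_mx 0 j) - 'd f x (delta_mx 0 j)| <= e'.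
  by move: j; near: x.
have -> : 'd f x v - 'd f x0 v =
    \sum_(j < m) v 0 j *: ('d f x (delta_mx 0 j) - 'd f x0 (delta_mx 0 j)).
  under eq_bigr do rewrite scalerBr.
  by rewrite sumrB; congr (_ - _); exact: linear_row_sum.
rewrite (le_trans (ler_norm_sum _ _ _))//.
apply: (@le_trans _ _ (\sum_(j < m) e' * `|v|)).
  apply: ler_sum => j _; rewrite normrZ mulrC distrC.
  by rewrite ler_pM// coord_le_norm.
rewrite sumr_const card_ord -mulrnAl ler_wpM2r// -mulr_natr /e' mulrAC.
by rewrite ler_pdivrMr// ler_pM2l// ler_nat.
Unshelve. all: by end_near.
Qed.

(** On a small ball [f - id] is Lipschitz with constant 1/2. This makes [f] injective and, by
    [near_identity_onto], open there; [Cn_inverse] then gives smoothness of the inverse. *)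
Theorem inverse_function m (f : 'rV[R]_m -> 'rV[R]_m) (U : set 'rV[R]_m) x0 :
  open U -> smooth_on U f -> U x0 -> 'd f x0 = id :> ('rV[R]_m -> 'rV[R]_m) ->
  exists (V : set 'rV[R]_m) (g : 'rV[R]_m -> 'rV[R]_m),
    [/\ open V /\ V `<=` U, V x0, open (f @` V),
        forall x, V x -> g (f x) = x & smooth_on (f @` V) g].
Proof.
move=> oU sf Ux0 df0.
have half0 : (0 : R) < 2^-1 by rewrite invr_gt0.
have : \forall x \near x0, U x /\ forall v, `|'d f x v - v| <= 2^-1 * `|v|.
  near=> x; split; first by near: x; exact: open_nbhs_nbhs.
  near: x; have := diff_close_near sf Ux0 half0.
  apply: filterS => x xP v; have dv : 'd f x0 v = v := congr1 (@^~ v) df0.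
  by rewrite -[X in _ - X]dv; exact: xP.
move=> /nbhs_normP[r /= r0 rP].
pose V : set 'rV[R]_m := [set x : 'rV[R]_m | `|x - x0| < r].
have VU (x : 'rV[R]_m) : V x -> U x by move=> Vx; apply: (rP x _).1; rewrite /ball_/= distrC.
have dV (x v : 'rV[R]_m) : V x -> `|'d f x v - v| <= 2^-1 * `|v|.
  by move=> Vx; apply: (rP x _).2; rewrite /ball_/= distrC.
have oV : open V.
  rewrite openE => x Vx; apply: (nbhs_normP x V).2; exists (r - `|x - x0|) => /=.
    by rewrite subr_gt0.
  move=> y /=; rewrite distrC ltrBrDr => xy.
  by rewrite /V /= -[y - x0](subrKA x) (le_lt_trans (ler_normD _ _)).
have Vx0 : V x0 by rewrite /V /= subrr normr0.
have fid (x y : 'rV[R]_m) : V x -> V y -> `|f x - f y - (x - y)| <= 2^-1 * `|x - y|.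
  have dfid z : V z -> is_diff z (f - id) (('d f z : 'rV[R]_m -> 'rV[R]_m) - id).
    move=> Vz; have := smooth_differentiable sf (VU _ Vz).
    by move=> /differentiableP dz; apply: is_diffB.
  have := @mean_value_rV _ m (f - id) x0 r _ (ltW half0).
  rewrite (_ : f x - f y - (x - y) = (f - id) x - (f - id) y); last first.
    by rewrite opprB addrA -[RHS]/(f x - x - (f y - y)) opprB addrA addrAC
      [in RHS]addrAC [f x - x - _]addrAC.
  apply => z; first by move=> /dfid dz; exact: ex_diff.
  by move=> v Vz; have dz := dfid _ Vz; rewrite diff_val; exact: dV.
(* This yields injectivity of [f] and continuity of its inverse. *)
have expand (x y : 'rV[R]_m) : V x -> V y -> `|x - y| <= 2 * `|f x - f y|.
  move=> Vx Vy; have := fid _ _ Vx Vy.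
  have := ler_normB (f x - f y) (f x - f y - (x - y)).
  by rewrite opprB addrC subrK; lra.
have oW : open (f @` V).
  rewrite openE => _ [x Vx <-]; apply: (nbhs_normP (f x) (f @` V)).2.
  (* Half the distance left to the boundary of the ball, so that the closed ball of radius [q]
     around [x] lies in the open [V]. *)
  pose q := 2^-1 * (r - `|x - x0|).
  have q0 : 0 < q by rewrite mulr_gt0// subr_gt0.
  exists (2^-1 * q) => /=; first by rewrite mulr_gt0.
  move=> y /=; rewrite distrC => /ltW yx.
  have BV z : `|z - x| <= q -> V z.
    move=> zx; rewrite /V /= -[z - x0](subrKA x) (le_lt_trans (ler_normD _ _))//.
    by move: zx q0; rewrite /q; lra.
  have [|z /BV Vz <-] := near_identity_onto (ltW q0) _ yx; last by exists z.
  by move=> z z' /BV Vz /BV Vz'; exact: fid.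
pose g y := xget x0 [set x | V x /\ f x = y].
have gP y : (f @` V) y -> V (g y) /\ f (g y) = y.
  by move=> [x Vx fx]; apply: (@xgetPex _ x0 [set x | V x /\ f x = y]); exists x.
exists V, g; split=> // [x Vx|n].
  have [Vg fg] : V (g (f x)) /\ f (g (f x)) = f x by apply: gP; exists x.
  apply/eqP; rewrite -subr_eq0 -normr_le0 (le_trans (expand _ _ Vg Vx))//.
  by rewrite fg subrr normr0 mulr0.
have dfV x v : V x -> `|v| <= 2 * `|'d f x v|.
  move=> Vx; have := dV x v Vx.
  have := ler_normB ('d f x v) ('d f x v - v).
  by rewrite opprB addrC subrK; lra.
apply: (@Cn_inverse R n _ _ V (f @` V) f g oV oW).
- by move=> k; exact: Cn_sub (sf k).
- by move=> y /gP[].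
- by move=> y /gP[].
- move=> y Wy; apply/(@cvgrPdist_le _ _ _ (nbhs y)) => e e0.
  have Wz := open_nbhs_nbhs (conj oW Wy : open_nbhs y (f @` V)).
  have yz : \forall z \near y, `|y - z| <= 2^-1 * e.
    have /(@cvgrPdist_le _ _ _ (nbhs y)) := @cvg_id _ (nbhs y).
    by apply; rewrite mulr_gt0.
  apply: filterS2 Wz yz => z Wz yz.
  rewrite (le_trans (expand _ _ (gP _ Wy).1 (gP _ Wz).1))//.
  by rewrite (gP _ Wy).2 (gP _ Wz).2 -ler_pdivlMl.
(* ['d f x] is itself within 1/2 of the identity, so [near_identity_onto] solves the linear equation
   in the ball of radius [2 * |w|] around 0. *)
- move=> x w Vx.
  have [|||v _ <-] := @near_identity_onto _ ('d f x) 0 w (2 * `|w|); last by exists v.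
  + by rewrite mulr_ge0.
  + by move=> v v' _ _; rewrite -linearB /=; exact: dV.
  + by rewrite linear0 subr0 mulrA mulVf// mul1r.
- move=> x Vx; exists 2 => //; apply: filterS (open_nbhs_nbhs (conj oV Vx)) => z Vz v.
  exact: dfV.
Unshelve. all: by end_near.
Qed.

End inverse_function_theorem.

(** * Separating functionals *)

HB.instance Definition _ (R : realType) (X Y : normedModType R) (f : bop X Y) :=
  GRing.isLinear.Build R X Y _ (bop_fun f) (bop_linear f).

Section bounded_functionals.
Set Implicit Arguments.
Unset Strict Implicit.
Variable R : realType.

Lemma mk_bop (X Y : normedModType R) (f : X -> Y) (C : R) :
  linear f -> (forall x, `|f x| <= C * `|x|) -> exists g : bop X Y, g = f :> (X -> Y).
Proof.
move=> lf bf; have fP : f \in bounded_op (E := X) (F := Y).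
  by apply/asboolP; split=> //; exists C.
by exists (Bop fP).
Qed.

Lemma bop_continuous (X Y : normedModType R) (f : bop X Y) : continuous f.
Proof.
apply: bounded_linear_continuous.
apply/linear_boundedP; near=> r => x; rewrite (le_trans (opnormP f x))//.
by rewrite ler_wpM2r//; near: r; apply: nbhs_pinfty_ge; rewrite num_real.
Unshelve. all: by end_near.
Qed.

Lemma bop_sumE (X Y : normedModType R) m (f : 'I_m -> bop X Y) (x : X) :
  (\sum_(i < m) f i) x = \sum_(i < m) f i x.
Proof. by elim/big_ind2 : _ => // u1 u2 v1 v2 <- <-. Qed.

(** Induction on [k]: fewer than [m] functionals all vanish at [L v] for some nonzero [v], and a
    functional not vanishing at [L v] is independent of them. *)
Lemma independent_functionals (X : normedModType R) m (L : {linear 'rV[R]_m -> X}) k :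
  (forall v, v != 0 -> exists phi : bop X R, phi (L v) != 0) -> (k <= m)%N ->
  exists phi : 'I_k -> bop X R,
    row_free (\matrix_(i < k, j < m) phi i (L (delta_mx 0 j)) : 'M[R]_(k, m)).
Proof.
move=> sep; elim: k => [|k IHk] km.
  by exists (fun=> 0); apply: inj_row_free => v _; exact: thinmx0.
have [phi] := IHk (ltnW km); set A := \matrix_(i, j) _ => fA.
have : kermx A^T != 0.
  by rewrite -mxrank_eq0 mxrank_ker mxrank_tr (eqnP fA) -lt0n subn_gt0.
move=> /rowV0Pn[v /sub_kermxP vA v0]; have [psi psiv] := sep _ v0.
have psiE : psi (L v) = \sum_(j < m) v 0 j * psi (L (delta_mx 0 j)).
  exact: (linear_row_sum (psi \o L)).
pose w : 'rV[R]_m := \row_j psi (L (delta_mx 0 j)).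
pose phi' (i : 'I_(1 + k)) := match fintype.split i with inl _ => psi | inr j => phi j end.
rewrite -[k.+1]/(1 + k)%N; exists phi'.
have -> : \matrix_(i < 1 + k, j < m) phi' i (L (delta_mx 0 j)) = col_mx w A.
  apply/matrixP => i j; rewrite !mxE /phi'; case: fintype.splitP => i' _; by rewrite !mxE.
apply: inj_row_free => /= u; rewrite -[u](@hsubmxK _ 1 1 k) mul_row_col => uA.
(* Multiplying a relation among the rows by [v^T] kills the rows of [A], so the coefficient of [psi]
   is 0 and independence of the old rows finishes. *)
have wv : w *m v^T = (psi (L v))%:M.
  apply/matrixP => i j; rewrite !ord1 !mxE eqxx mulr1n psiE.
  by apply: eq_bigr => l _; rewrite !mxE mulrC.
have Av : A *m v^T = 0 by rewrite -[LHS]trmxK trmx_mul trmxK vA trmx0.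
have := congr1 (mulmx^~ v^T) uA; rewrite mulmxDl -!mulmxA Av mulmx0 addr0 wv mul0mx.
rewrite mul_mx_scalar => /eqP; rewrite scaler_eq0 (negbTE psiv) /= => /eqP u1.
move: uA; rewrite u1 mul0mx add0r -(mul0mx _ A) => u2.
by rewrite (row_free_inj fA u2) row_mx0.
Qed.

(** For [k = m] the matrix of independent functionals is square and invertible; the rows of its
    inverse are the coefficients of the dual family. *)
Lemma dual_functionals (X : normedModType R) m (L : {linear 'rV[R]_m -> X}) :
  (forall v, v != 0 -> exists phi : bop X R, phi (L v) != 0) ->
  exists psi : 'I_m -> bop X R, forall i v, psi i (L v) = v 0 i.
Proof.
move=> /independent_functionals /(_ (leqnn m))[phi].
set A := \matrix_(i, j) _; rewrite row_free_unit => uA.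
exists (fun i => \sum_(k < m) invmx A i k *: phi k) => i v.
rewrite bop_sumE.
have -> : \sum_(k < m) (invmx A i k *: phi k) (L v) =
    (v *m (invmx A *m A)^T) 0 i.
  rewrite trmx_mul mulmxA mxE; apply: eq_bigr => k _.
  rewrite [X in _ = _ * X]mxE mulrC -[LHS]/(invmx A i k * phi k (L v)).
  congr (_ * _).
  rewrite [LHS](linear_row_sum (phi k \o L)) mxE; apply: eq_bigr => j _.
  by rewrite !mxE.
by rewrite mulVmx// trmx1 mulmx1.
Qed.

End bounded_functionals.

(** * Charts and changes of tangent coordinates *)

Section charts.
Set Implicit Arguments.
Unset Strict Implicit.
Variable R : realType.

(** Inside the open chart image, the image of [O] is its preimage under the continuous [cinv c]. *)
Lemma open_chart_img (X : topologicalType) (V : normedModType R)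
    (c : chart X V) (O : set X) :
  open O -> O `<=` cdom c -> open (cmap c @` O).
Proof.
move=> oO Oc; rewrite openE => _ [x Ox <-].
have Dx : (cmap c @` cdom c) (cmap c x) by exists x => //; exact: Oc.
have nD := open_nbhs_nbhs (conj (cimg_open c) Dx).
have nO : nbhs (cmap c x) (cinv c @^-1` O).
  apply: (cinv_continuous Dx); rewrite (cmapK (Oc _ Ox)).
  exact: open_nbhs_nbhs.
apply: filterS2 nD nO => z [x' Dx' <-]; rewrite /preimage /= cmapK// => Ox'.
by exists x'.
Qed.

Variables (V : normedModType R) (M : manifold V).

Lemma chart_compat_diff (q q' x : M) :
  cdom (chart_at q) x -> cdom (chart_at q') x ->
  differentiable (cmap (chart_at q') \o cinv (chart_at q)) (cmap (chart_at q) x).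
Proof.
move=> Dx D'x; apply: (smooth_differentiable (@chart_compat R V M q q')).
by exists x.
Qed.

(** The two transition maps compose to the identity near the point; differentiate with the chain
    rule. *)
Lemma tchangeK (q q' x : M) :
  cdom (chart_at q) x -> cdom (chart_at q') x ->
  cancel (tchange q q' x) (tchange q' q x).
Proof.
move=> Dx D'x v; have d1 := chart_compat_diff Dx D'x.
have d2 := chart_compat_diff D'x Dx.
pose z := cmap (chart_at q) x.
have zx : cinv (chart_at q) z = x by exact: cmapK.
have d2' : differentiable (cmap (chart_at q) \o cinv (chart_at q'))
    ((cmap (chart_at q') \o cinv (chart_at q)) z) by rewrite /= zx.
have := diff_comp d1 d2'; rewrite /= -/z zx => dc.
have [| |_ did] := @near_eq_diff R _ _ id ((cmap (chart_at q) \o cinv (chart_at q'))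
    \o (cmap (chart_at q') \o cinv (chart_at q))) z.
- have oD : open (cmap (chart_at q) @` (cdom (chart_at q) `&` cdom (chart_at q'))).
    by apply: open_chart_img; [apply: openI; exact: cdom_open|move=> ? []].
  have Dz : (cmap (chart_at q) @` (cdom (chart_at q) `&` cdom (chart_at q'))) z.
    by exists x.
  apply: filterS (open_nbhs_nbhs (conj oD Dz)) => _ [y [Dy D'y] <-] /=.
  by rewrite (cmapK Dy) (cmapK D'y).
- by [].
by have := congr1 (@^~ v) dc; rewrite did diff_val /= => /esym.
Qed.

End charts.

(** * Evaluation functionals on section spaces and operator pairs *)

Section section_evaluation.
Set Implicit Arguments.
Unset Strict Implicit.
Context {R : realType} {n d l : nat}.
Context {M : smooth_manifold (R := R) n} {N : smooth_manifold (R := R) d}.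
Context {K : lie_group (R := R) l} {aM : lie_action K M} {aN : lie_action K N}.
Context {k : nat} {alpha : R} {f : M -> N} {cov : chart_cover f}.
Context {P : set (M -> 'rV[R]_d)} (SS : section_space aM aN k alpha cov P).

Lemma holder_le_partials0 (A : set 'rV[R]_n) (F : 'rV[R]_n -> 'rV[R]_d) :
  F = cst 0 -> holder_le k alpha A F 0.
Proof.
move=> ->; have p0 s : partials s (cst 0 : 'rV[R]_n -> 'rV[R]_d) = cst 0.
  elim: s => [//|i s /= ->]; apply/funext => z.
  by rewrite /partial derive_cst.
by split=> [s z _ _|s z z' _ _ _]; rewrite p0 ?subrr normr0 ?mul0r.
Qed.

(** The zero section satisfies the Hoelder bound 0, and [ss_norm] bounds the norm of [w] by a
    multiple of it. *)
Lemma ss_sec_eq0 (w : SS) : (forall x, ss_sec w x = 0) -> w = 0.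
Proof.
move=> w0; have [C C0 /(_ w)[_ bC]] := ss_norm SS.
apply/eqP; rewrite -normr_le0 -(mulr0 C); apply: bC => j.
apply: holder_le_partials0; apply/funext => z.
by rewrite /section_rep w0 /tchange linear0.
Qed.

Lemma ss_separating (w : SS) : w != 0 -> exists phi : bop SS R, phi w != 0.
Proof.
move=> w0; have [x wx] : exists x, ss_sec w x != 0.
  apply/not_existsP => w'; move/eqP: w0; apply; apply: ss_sec_eq0 => x.
  by apply/eqP/negPn/negP; exact: w'.
have [j /interior_subset xj] := cc_cover cov x.
set q := cc_pt j in xj; pose F (u : SS) := tchange (f x) (f q) (f x) (ss_sec u x).
have Dfx : cdom (chart_at (f q)) (f x) by apply: (@cc_target _ _ _ _ _ f cov j); exists x.
(* Passing to the chart at [f q], where the Hoelder norm is measured, is invertible and so loses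
   nothing. *)
have Fw : F w != 0.
  apply: contra_neq wx => Fw0.
  have := tchangeK (chart_at_dom (f x)) Dfx (ss_sec w x).
  by rewrite -/(F w) Fw0 /tchange linear0.
have [i Fwi] : exists i, F w 0 i != 0.
  apply/not_existsP => Fw'; move/eqP: Fw; apply; apply/rowP => i.
  by rewrite mxE; apply/eqP/negPn/negP; exact: Fw'.
have [C C0 bC] := ss_norm SS.
have lF : linear (fun u => F u 0 i : R).
  by move=> a u v; rewrite /F ss_linear /tchange linearP !mxE.
have bF (u : SS) : `|F u 0 i| <= C * `|u|.
  apply: le_trans (coord_le_norm _ _) _.
  (* The derivative of order 0, indexed by the empty sequence, gives the sup bound. *)
  have [/(_ j)[+ _] _] := bC u.
  move=> /(_ [::] (cmap (chart_at q) x) isT) /=.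
  rewrite /section_rep (cmapK (cc_dom xj)); apply.
  by exists x.
by have [phi phiE] := mk_bop lF bF; exists phi; rewrite phiE.
Qed.

End section_evaluation.

(** A nonzero component of the pair is nonzero at some [u]; a functional detecting that value,
    composed with evaluation at [u], is bounded for the operator norm. *)
Lemma bop_prod_separating (R : realType) (X Y : normedModType R) :
  (forall w : X, w != 0 -> exists phi : bop X R, phi w != 0) ->
  (forall w : Y, w != 0 -> exists phi : bop Y R, phi w != 0) ->
  forall w : (bop X Y * bop Y X)%type, w != 0 ->
  exists phi : bop (bop X Y * bop Y X)%type R, phi w != 0.
Proof.
have bop_neq0 (X' Y' : normedModType R) (A : bop X' Y') : A != 0 ->
    exists u, A u != 0.
  move=> A0; apply/not_existsP => A'; move/eqP: A0; apply.
  by apply/val_inj/funext => u; apply/eqP/negPn/negP; exact: A'.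
have ev (X' Y' : normedModType R) (A : bop X' Y') (phi : bop Y' R) (u : X') :
    `|phi (A u)| <= opnorm phi * `|u| * `|A|.
  rewrite (le_trans (opnormP _ _))// -mulrA ler_wpM2l ?opnorm_ge0// mulrC.
  exact: opnormP.
move=> sepX sepY [A B]; have [->|A0 _] := eqVneq A 0.
  have [->|B0 _] := eqVneq B 0; first by rewrite eqxx.
  have [u /sepX[phi phi0]] := bop_neq0 _ _ _ B0.
  have lg : linear (fun w : (bop X Y * bop Y X)%type => phi (w.2 u)).
    move=> a w w'; rewrite -[LHS]/(phi (a *: w.2 u + w'.2 u)).
    by rewrite linearP.
  have bg (w : (bop X Y * bop Y X)%type) :
      `|phi (w.2 u)| <= opnorm phi * `|u| * `|w|.
    rewrite (le_trans (ev _ _ _ _ _))// ler_wpM2l ?mulr_ge0 ?opnorm_ge0//.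
    by rewrite prod_normE le_max lexx orbT.
  by have [g gE] := mk_bop lg bg; exists g; rewrite gE.
have [u /sepY[phi phi0]] := bop_neq0 _ _ _ A0.
have lg : linear (fun w : (bop X Y * bop Y X)%type => phi (w.1 u)).
  move=> a w w'; rewrite -[LHS]/(phi (a *: w.1 u + w'.1 u)).
  by rewrite linearP.
have bg (w : (bop X Y * bop Y X)%type) :
    `|phi (w.1 u)| <= opnorm phi * `|u| * `|w|.
  rewrite (le_trans (ev _ _ _ _ _))// ler_wpM2l ?mulr_ge0 ?opnorm_ge0//.
  by rewrite prod_normE le_max lexx.
by have [g gE] := mk_bop lg bg; exists g; rewrite gE.
Qed.

(** * Local diffeomorphisms *)

(** The inverse function theorem is applied to the representative of [f] in the preferred chart at
    [p0], and its inverse is carried back by [cinv]. *)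
Lemma local_diffeo_mdiff_id (R : realType) m (M : manifold 'rV[R]_m)
    (f : M -> flat 'rV[R]_m) (p0 : M) :
  msmooth_on setT f -> mdiff f p0 = id -> local_diffeo_at f p0.
Proof.
move=> sf df0; have [W [oW Wp0 Wc _ sF]] := sf p0 I.
set c := chart_at p0 in Wc sF; set F := chart_rep f p0 in sF.
have oO := open_chart_img oW Wc; set O := _ @` W in oO sF.
have Oz0 : O (cmap c p0) by exists p0.
have [V [g [[oV VO] Vz0 oFV gK sg]]] := inverse_function oO sF Oz0 df0.
have cinvW z : V z -> W (cinv c z) /\ cmap c (cinv c z) = z.
  by move=> /VO[x Wx <-]; rewrite (cmapK (Wc _ Wx)).
pose U := [set x | W x /\ V (cmap c x)].
have oU : open U.
  rewrite openE => x [Wx Vx]; apply: filterI; first exact: open_nbhs_nbhs.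
  by apply: (cmap_continuous (Wc _ Wx)); exact: open_nbhs_nbhs.
have FE x : U x -> F (cmap c x) = f x.
  by move=> [Wx _]; rewrite /F /chart_rep /= (cmapK (Wc _ Wx)).
have fU : f @` U = F @` V.
  apply/seteqP; split=> [_ [x Ux <-]|_ [z Vz <-]].
    by exists (cmap c x); [case: Ux|exact: FE].
  have [Wz zK] := cinvW _ Vz.
  by exists (cinv c z) => //; split=> //; rewrite zK.
exists U, (F @` V), (cinv c \o g); split=> //.
- move=> x Ux; rewrite /= -(FE _ Ux) gK; last by case: Ux.
  by case: Ux => /Wc/cmapK.
- by move=> x _; exact: sf.
(* Smoothness of the inverse at [y] is tested in the preferred chart [c'] at its value [p], not in
   [c]; so [g] is followed by the transition map, on the open set [W'] where this is defined. *)
move=> y Wy; set p := (cinv c \o g) y; set c' := chart_at p.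
pose O' := cmap c @` (cdom c `&` cdom c').
have oO' : open O'.
  by apply: open_chart_img; [apply: openI; exact: cdom_open|move=> ? []].
pose W' := [set y' | (F @` V) y' /\ O' (g y')].
have oW' : open W'.
  rewrite openE => y' [Fy' Oy']; apply: filterI; first exact: open_nbhs_nbhs.
  by apply: (sg 0%N _ Fy'); exact: open_nbhs_nbhs.
exists W'; split=> //.
- split=> //; case: Wy @p @c' @O' {oO' W' oW'} => z Vz <- p c' O'.
  have [Wz zK] := cinvW _ Vz; exists p; last by rewrite /p /= gK.
  split; last exact: chart_at_dom.
  by rewrite /p /= gK//; exact: Wc.
- by move=> _ [y' [_ [x [Dx D'x] xg]] <-]; rewrite /= -xg cmapK.
rewrite [cmap _ @` W']image_id.
apply: (@smooth_comp _ _ _ _ W' O' g (cmap c' \o cinv c)) => //.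
- by move=> y' [].
- by move=> n; apply: Cn_sub (sg n) => y' [].
- exact: chart_compat.
Qed.

(** * Joint maps of finitely many bounded functionals *)

Section functional_row.
Set Implicit Arguments.
Unset Strict Implicit.
Variables (R : realType) (X : normedModType R) (m : nat).
Variable psi : 'I_m -> bop X R.

Definition functional_row (x : X) : 'rV[R]_m := \row_i psi i x.

Lemma functional_row_linear : linear functional_row.
Proof. by move=> a u v; apply/rowP => i; rewrite !mxE linearP. Qed.

Lemma functional_row_continuous : continuous functional_row.
Proof.
have [x|g <-] := mk_bop (C := \sum_(i < m) opnorm (psi i)) functional_row_linear.
  apply: norm_le_coord => [|i].
    by rewrite mulr_ge0// sumr_ge0// => i _; exact: opnorm_ge0.
  rewrite mxE (le_trans (opnormP _ _))// ler_wpM2r// (bigD1 i)//= lerDl.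
  by rewrite sumr_ge0// => j _; exact: opnorm_ge0.
exact: bop_continuous.
Qed.

HB.instance Definition _ :=
  GRing.isLinear.Build R X 'rV[R]_m _ functional_row functional_row_linear.

Lemma diff_functional_row x : 'd functional_row x = functional_row :> (X -> 'rV[R]_m).
Proof. exact: (diff_lin x functional_row_continuous). Qed.

Lemma functional_row_smooth : smooth_on setT functional_row.
Proof.
by move=> k; exact: Cn_linear functional_row_linear functional_row_continuous.
Qed.

End functional_row.

(** * Reconstruction of the parameter and of the metric *)

Theorem corollary5p45 (R : realType) (m n d l : nat)
    (S : @smooth_manifold R m) (M : @smooth_manifold R n)
    (N : @smooth_manifold R d) (K : @lie_group R l)
    (aM : lie_action K M) (aN : lie_action K N)
    (lam len alpha : R) (k : nat) (gam : R -> M)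
    (g : S -> M -> 'M[R]_n) (p0 : S)
    (compactM : compact [set: M]) (compactN : compact [set: N])
    (lam_gt0 : 0 < lam) (k_ge4 : (4 <= k)%N)
    (alpha_gt0 : 0 < alpha) (alpha_lt1 : alpha < 1)
    (einstein_g : einstein_family aM lam len gam g)
    (P : probe aM aN k alpha (g p0)) (T : local_trivialization P)
    (C : core_package T g)
    (injective_D : injective (response_differential C p0)) :
  exists psi : 'I_m -> core_space P -> R,
    [/\ forall i, exists O : set (core_space P),
          [/\ open O, O (core_map C p0) & smooth_on O (psi i)],
        bijective (mdiff (joint_observation C psi) p0),
        local_diffeo_at (joint_observation C psi) p0,
        exists (U : set S) (rec : 'rV[R]_m -> S),
          [/\ open U, U p0 &
              forall p, U p -> rec (joint_observation C psi p) = p] &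
        (exists U : set S, [/\ open U, U p0 & {in U &, injective g}]) ->
        exists (U : set S) (rec : 'rV[R]_m -> M -> 'M[R]_n),
          [/\ open U, U p0,
              forall p, U p -> rec (joint_observation C psi p) = g p &
              forall p q, U p -> U q ->
                (joint_observation C psi p = joint_observation C psi q
                 <-> g p = g q)]].
Proof.
pose z0 := cmap (chart_at p0) p0.
pose L := 'd (chart_rep (core_map C) p0) z0.
have sep (w : core_space P) : w != 0 ->
    exists phi : bop (core_space P) R, phi w != 0.
  exact: (bop_prod_separating (ss_separating (SS := pr_E P))
    (ss_separating (SS := pr_F P))).
(* [L] is the response differential, so injectivity makes [L v] nonzero and [sep] provides a
   functional detecting it. *)
have [v v0|psi psiL] := @dual_functionals R (core_space P) m L.
  apply: sep; apply: contra_neq v0 => Lv0; apply: injective_D.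
  by rewrite -[LHS]/(L v) -[RHS]/(L 0) linear0.
pose obs := joint_observation C psi.
(* Both targets are flat, with the identity as chart. *)
have rowE p : chart_rep obs p = functional_row psi \o chart_rep (core_map C) p.
  by [].
have smooth_obs : msmooth_on setT obs.
  move=> p _; have [W [oW Wp Wc _ sC]] := cp_smooth C (x := p) I.
  exists W; split=> //; rewrite rowE.
  apply: (smooth_comp (open_chart_img oW Wc) _ sC (functional_row_smooth psi)).
  by [].
have d_obs : mdiff obs p0 = id.
  have [W [oW Wp Wc _ sC]] := cp_smooth C (x := p0) I.
  have dC : differentiable (chart_rep (core_map C) p0) z0.
    by apply: smooth_differentiable sC _; exists p0.
  rewrite /mdiff rowE.
  have dpsi : differentiable (functional_row psi) (chart_rep (core_map C) p0 z0).
    exact: smooth_differentiable (functional_row_smooth psi) _.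
  apply/funext => v; rewrite (diff_comp dC dpsi) /=.
  rewrite diff_functional_row.
  by apply/rowP => i; rewrite mxE psiL.
have diffeo := @local_diffeo_mdiff_id R m S obs p0 smooth_obs d_obs.
exists psi; split=> //.
- move=> i; exists setT; split=> //; first exact: openT.
  by move=> n'; apply: Cn_linear; [exact: bop_linear|exact: bop_continuous].
- by rewrite -/obs d_obs; exists id.
- have [U [W [finv [[oU _] [Up0 _] finvK _ _]]]] := diffeo.
  by exists U, finv; split.
(* The metric is recovered by applying [g] to the recovered parameter; on [U'] equal metrics force
   equal parameters, hence equal observations. *)
move=> [U' [oU' U'p0 g_inj]].
have [U [W [finv [[oU _] [Up0 _] finvK _ _]]]] := diffeo.
exists (U `&` U'), (g \o finv); split=> //.
- exact: openI.
- by move=> p [Up _]; rewrite /= finvK.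
move=> p q [Up U'p] [Uq U'q]; split=> [pq|gpq].
  by rewrite -(finvK _ Up) -(finvK _ Uq) /obs pq.
by rewrite (g_inj p q)// inE.
Qed.
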